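(* Let $q_0=\frac{\sqrt5-1}{2}$ and let $q\in(q_0,1)$. There exist a locally compact Hausdorff space $\Omega$ with countable base, a measure $\sigma\in\mathcal{M}^+(\Omega)$, and a symmetric, lower semicontinuous kernel $G\colon\Omega\times\Omega\to[0,+\infty]$ (not required to satisfy the weak maximum principle), such that there is a positive solution $u\in L^q(\Omega,\sigma)$ to $u=\mathbf{G}(u^q\,d\sigma)$, but $$\int_\Omega(\mathbf{G}\sigma)^{\frac{q}{1-q}}\,d\sigma=+\infty.$$
   Context: $\mathcal{M}^+(\Omega)$ is the class of nonnegative, locally finite Borel (Radon) measures on $\Omega$. $\mathbf{G}\nu(x)=\int_\Omega G(x,y)\,d\nu(y)$ and $\mathbf{G}(u^q\,d\sigma)(x)=\int_\Omega G(x,y)u(y)^q\,d\sigma(y)$. A positive solution is a function $u$ with $u=\mathbf{G}(u^q\,d\sigma)$ and $u>0$ $d\sigma$-a.e. The weak maximum principle (with constant $h\ge1$) for $G$ says: for every $M>0$ and $\nu\in\mathcal{M}^+(\Omega)$, $\mathbf{G}\nu\le M$ on the support of $\nu$ implies $\mathbf{G}\nu\le hM$ on $\Omega$. *)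

(* Defs.v *)
From HB Require Import structures.
From mathcomp Require Import all_boot all_order all_algebra.
From mathcomp Require Import all_classical all_reals all_analysis.
From mathcomp Require Import measurable_realfun.

Set Implicit Arguments.
Unset Strict Implicit.
Unset Printing Implicit Defensive.

Import Order.TTheory GRing.Theory Num.Theory.
Import numFieldNormedType.Exports.

Local Open Scope classical_set_scope.
Local Open Scope ring_scope.
Local Open Scope ereal_scope.

(* Generated sigma-algebras in the library are over pointed types, hence
   ptopologicalType: a nonempty topological space with a distinguished point. *)
Notation borel T := (g_sigma_algebraType (@open T)).

Definition locally_finite (R : realType) (T : ptopologicalType)
    (mu : {measure set (borel T) -> \bar R}) : Prop :=
  forall x : T, exists2 U : set T, open_nbhs x U & mu U < +oo.

Definition potential (R : realType) (T : ptopologicalType)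
    (G : T * T -> \bar R) (nu : {measure set (borel T) -> \bar R})
    (x : T) : \bar R :=
  \int[nu]_y G (x, y).

(* The potential G(f dsigma)(x) of the measure with density f with respect
   to sigma. *)
Definition density_potential (R : realType) (T : ptopologicalType)
    (G : T * T -> \bar R) (sigma : {measure set (borel T) -> \bar R})
    (f : T -> \bar R) (x : T) : \bar R :=
  \int[sigma]_y (G (x, y) * f y).

(* Solutions take values in [0, +oo]. The equation is required at every point:
   if it holds only sigma-a.e., replacing u by G(u^q dsigma) gives a solution
   at every point that equals u sigma-a.e. *)
Definition positive_solution (R : realType) (T : ptopologicalType)
    (G : T * T -> \bar R) (sigma : {measure set (borel T) -> \bar R})
    (q : R) (u : borel T -> \bar R) : Prop :=
  [/\ measurable_fun [set: borel T] u,
      forall x, 0 <= u x,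
      forall x, u x = density_potential G sigma (fun y => u y `^ q) x
    & {ae sigma, forall x, 0 < u x}].

(* Main.v *)
Require Import Defs.
From mathcomp Require Import all_boot all_order all_algebra.
From mathcomp Require Import all_classical all_reals all_analysis.
From mathcomp Require Import measurable_realfun.
From mathcomp Require Import lra.

(** On the discrete space [nat], take a star-shaped kernel with hub 0:
    G(0, j+1) = G(j+1, 0) = a_j and G = 0 elsewhere, with sigma({0}) = 1 and
    sigma({j+1}) = m_j.  If sum_j m_j a_j^(1+q) = 1 and a_j >= 1, then u(0) = 1,
    u(j+1) = a_j is a solution, and it lies in L^q since a_j^q <= a_j^(1+q).
    But G sigma(j+1) = a_j, so the energy is at least sum_j m_j a_j^s with
    s = q/(1-q).  The bound q > q_0 says exactly that 1 + q < s, which leaves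
    room for a geometric sequence a_j = 2^j with finite (1+q)-th moment and
    infinite s-th moment. *)

Import Order.TTheory GRing.Theory Num.Theory.
Import numFieldNormedType.Exports.

Local Open Scope classical_set_scope.
Local Open Scope ring_scope.
Local Open Scope ereal_scope.

Lemma discrete_locally_compact (T : discreteTopologicalType) :
  locally_compact [set: T].
Proof.
move=> x _; exists [set x]; first by rewrite /within nbhs_principalE; exact/principal_filterP.
by split; [exact: compact_set1 | exact: discrete_closed].
Qed.

Lemma nat_second_countable : @second_countable nat.
Proof.
exists (range (fun n : nat => [set n])); first exact: card_image_le.
split=> [_ [n _ <-]|x U xU]; first exact: discrete_open.
exists [set x]; first by split; [exists x | ].
by move=> _ ->; exact: nbhs_singleton.
Qed.

(** Discreteness makes the Borel sigma-algebra the full power set, so every measurability condition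
    below is automatic. *)
Lemma measurable_borel_nat (A : set (borel nat)) : measurable A.
Proof. by apply: sub_sigma_algebra; exact: discrete_open. Qed.

Lemma measurable_fun_borel_nat d (T : measurableType d)
    (D : set (borel nat)) (f : borel nat -> T) : measurable_fun D f.
Proof. by move=> _ Y _; exact: measurable_borel_nat. Qed.

Lemma lower_semicontinuous_nat2 (R : realType) (f : nat * nat -> \bar R) :
  lower_semicontinuous f.
Proof.
move=> [x y] a afx; exists [set (x, y)]; last by move=> _ ->.
exists ([set x], [set y]); first by split; exact: discrete_set1.
by move=> [x' y'] [/= -> ->].
Qed.

Section atomic.
Context {R : realType} (w : nat -> {nonneg R}%R).

Definition atom (n : nat) : {measure set (borel nat) -> \bar R} :=
  mscale (w n) (dirac (n : borel nat)).

Definition atomic : {measure set (borel nat) -> \bar R} := mseries atom 0.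

Lemma integral_atomic (f : borel nat -> \bar R) : (forall n, 0 <= f n) ->
  \int[atomic]_x f x = \sum_(n <oo) ((w n)%:num%:E * f n).
Proof.
move=> f0; rewrite ge0_integral_measure_series//; last first.
  exact: measurable_fun_borel_nat.
apply: eq_eseriesr => n _; rewrite ge0_integral_mscale//; last first.
  exact: measurable_fun_borel_nat.
rewrite integral_dirac//; last exact: measurable_fun_borel_nat.
by rewrite diracT mul1e.
Qed.

Lemma atomic_set1 (n : nat) : atomic [set n] = (w n)%:num%:E.
Proof.
(* The mass is rewritten as the integral of an indicator, so that [integral_atomic] turns it into a
   series with a single nonzero term. *)
have -> : atomic [set n] = \int[atomic]_x (\1_[set n] x)%:E.
  by rewrite integral_indic ?setIT//; exact: measurable_borel_nat.
rewrite integral_atomic => [|m]; last by rewrite lee_fin.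
rewrite (@nneseriesD1 _ _ n)//.
rewrite indicE mem_set// mule1 eseries0 ?adde0// => i _ /= ni.
by rewrite indicE memNset ?mule0//= => /eqP; rewrite (negbTE ni).
Qed.

Lemma atomic_locally_finite : locally_finite atomic.
Proof.
move=> n; exists [set n]; last by rewrite atomic_set1 ltry.
by split => //; exact: discrete_open.
Qed.

End atomic.

Lemma nneseries_cst_pinfty (R : realType) (c : R) : (0 < c)%R ->
  \sum_(n <oo) c%:E = +oo.
Proof.
move=> c0; apply/eqyP => A A0.
(* More than [A / c] terms, each equal to [c], already sum to at least [A]. *)
apply: le_trans (nneseries_lim_ge (Num.truncn (A / c)).+1 _); last first.
  by move=> n _; rewrite lee_fin ltW.
rewrite big_mkord sumEFin lee_fin sumr_const card_ord -mulr_natr mulrC.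
by rewrite -ler_pdivrMr// ltW// truncnS_gt.
Qed.

Lemma nneseries_geometric (R : realType) (a z : R) :
    (0 <= a)%R -> (0 <= z < 1)%R ->
  \sum_(n <oo) (a * z ^+ n)%:E = (a * (1 - z)^-1)%:E.
Proof.
move=> a0 /andP[z0 z1].
have h : series (geometric a z) @ \oo --> (a * (1 - z)^-1)%R.
  by apply: cvg_geometric_series; rewrite ger0_norm.
rewrite -(cvg_lim _ h)// -EFin_lim; last by apply/cvg_ex; exists (a * (1 - z)^-1)%R.
by apply/congr_lim/funext => n /=; rewrite /series/= sumEFin.
Qed.

(** With [z = 2^(p-s) < 1], [a_j = 2^j] and [m_j = (1-z) 2^(-js)], the terms of order [p] are
    [(1-z) z^j], which sum to 1, while those of order [s] are all equal to [1-z > 0]. *)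
Lemma exists_critical_moments {R : realType} {p s : R} : (p < s)%R ->
  exists a m : nat -> R,
    [/\ forall j, (1 <= a j)%R, forall j, (0 <= m j)%R,
        \sum_(j <oo) (m j * a j `^ p)%:E = 1 &
        \sum_(j <oo) (m j * a j `^ s)%:E = +oo].
Proof.
move=> ps; pose z : R := (2 `^ (p - s))%R.
have z0 : (0 < z)%R by rewrite powR_gt0.
have z1 : (z < 1)%R.
  rewrite /z -opprB powRN invf_lt1 ?powR_gt0//.
  have := @gt0_ltr_powR R (s - p) _ 1%R 2%R.
  by rewrite powR1 !nnegrE; apply => //; lra.
have aE x j : ((2 ^+ j) `^ x = 2 `^ (j%:R * x) :> R)%R.
  by rewrite powRrM powR_mulrn.
exists (fun j => 2 ^+ j)%R, (fun j => (1 - z) * 2 `^ (j%:R * - s))%R; split.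
- by move=> j; rewrite exprn_ege1// ler1n.
- by move=> j; rewrite mulr_ge0 ?powR_ge0// subr_ge0 ltW.
- have -> : 1 = ((1 - z) * (1 - z)^-1)%:E :> \bar R.
    by rewrite divff// subr_eq0 eq_sym lt_eqF.
  rewrite -nneseries_geometric ?subr_ge0 ?(ltW z1) ?(ltW z0)//.
  apply: eq_eseriesr => j _; rewrite -mulrA aE -powRD; last by rewrite pnatr_eq0 implybT.
  congr ((_ * _)%:E); rewrite -mulrDr addrC mulrC powRrM.
  by rewrite powR_mulrn ?powR_ge0.
- rewrite -[RHS](@nneseries_cst_pinfty _ (1 - z)) ?subr_gt0//.
  apply: eq_eseriesr => j _; rewrite -mulrA aE -powRD; last by rewrite pnatr_eq0 implybT.
  by rewrite -mulrDr addNr mulr0 powRr0 mulr1.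
Qed.

Definition star_weight {R : realType} (m : nat -> {nonneg R}%R) (n : nat) :
    {nonneg R}%R :=
  if n is j.+1 then m j else 1%:nng%R.

(** The weak maximum principle fails as soon as some [a j] is positive: the potential of a unit mass
    at the hub vanishes at the hub but equals [a j] at the leaf [j.+1]. *)
Definition star_kernel {R : realType} (a : nat -> R) (z : nat * nat) : \bar R :=
  match z with
  | (0, j.+1) | (j.+1, 0) => (a j)%:E
  | _ => 0
  end.

Section star.
Context {R : realType} (a : nat -> R) (m : nat -> {nonneg R}%R).
Hypothesis a1 : forall j, (1 <= a j)%R.

Let a0 j : (0 <= a j)%R. Proof. exact: le_trans (a1 j). Qed.

Notation G := (star_kernel a).
Notation sigma := (atomic (star_weight m)).

Lemma star_kernel_ge0 z : 0 <= G z.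
Proof. by case: z => -[|i] [|j] //=; rewrite lee_fin. Qed.

Lemma star_kernel_sym x y : G (x, y) = G (y, x).
Proof. by case: x y => [|i] [|j]. Qed.

Lemma integral_star (f : borel nat -> \bar R) : (forall n, 0 <= f n) ->
  \int[sigma]_x f x = f 0%N + \sum_(j <oo) ((m j)%:num%:E * f j.+1).
Proof.
move=> f0; rewrite integral_atomic// nneseries_recl//=; last first.
  by move=> k _; rewrite mule_ge0// lee_fin.
(* The hub has weight 1; the remaining series starts at index 1 and is shifted so that the leaf
   [j.+1] gets index [j]. *)
rewrite mul1e -(nneseries_addn 1); last by move=> k; rewrite mule_ge0// lee_fin.
by congr (_ + _); apply: eq_eseriesr => j _; rewrite addn1.
Qed.

Lemma star_density_potential0 (f : nat -> \bar R) : (forall n, 0 <= f n) ->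
  density_potential G sigma f 0%N =
  \sum_(j <oo) ((m j)%:num%:E * ((a j)%:E * f j.+1)).
Proof.
move=> f0; rewrite /density_potential integral_star/= ?mul0e ?add0e// => n.
exact: mule_ge0 (star_kernel_ge0 (0%N, n)) (f0 n).
Qed.

(** The kernel vanishes between leaves, so a leaf sees only the hub, which has mass 1. *)
Lemma star_density_potentialS (f : nat -> \bar R) j : (forall n, 0 <= f n) ->
  density_potential G sigma f j.+1 = (a j)%:E * f 0%N.
Proof.
move=> f0; rewrite /density_potential integral_star/=.
  by rewrite eseries0 ?adde0// => i _ _; rewrite mul0e mule0.
by move=> n; exact: mule_ge0 (star_kernel_ge0 (j.+1, n)) (f0 n).
Qed.

Lemma star_potentialS j : potential G sigma j.+1 = (a j)%:E.
Proof.
rewrite -[RHS]mule1 -(@star_density_potentialS (fun=> 1)) => [|n]; last first.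
  by rewrite lee_fin.
by apply: eq_integral => y _; rewrite mule1.
Qed.

Lemma integral_star_potential_pinfty (s : R) :
  \sum_(j <oo) ((m j)%:num * a j `^ s)%:E = +oo ->
  \int[sigma]_x (potential G sigma x `^ s) = +oo.
Proof.
move=> as_oo; rewrite integral_star => [|n]; last exact: poweR_ge0.
under eq_eseriesr do rewrite star_potentialS poweR_EFin -EFinM.
(* The leaves alone give [+oo]; the hub term only has to differ from [-oo], which its nonnegativity
   ensures. *)
by rewrite as_oo addey// gt_eqF// (lt_le_trans (ltNyr 0))// poweR_ge0.
Qed.

Definition star_solution (n : nat) : \bar R := if n is j.+1 then (a j)%:E else 1.

Lemma star_solution_gt0 n : 0 < star_solution n.
Proof. by case: n => [|j] //=; rewrite lte_fin ?(lt_le_trans _ (a1 j)). Qed.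

Context (q : R).
Hypothesis q0 : (0 < q)%R.
Hypothesis ma1 : \sum_(j <oo) ((m j)%:num * a j `^ (1 + q))%:E = 1.

(** At the hub the equation is the normalisation [ma1], since [a_j a_j^q = a_j^(1+q)]; at a leaf it
    reads [a_j = a_j 1^q]. *)
Lemma star_solution_positive : positive_solution G sigma q star_solution.
Proof.
split.
- exact: measurable_fun_borel_nat.
- by move=> n; exact/ltW/star_solution_gt0.
- case=> [|j].
    rewrite star_density_potential0 => [|n]; last exact: poweR_ge0.
    rewrite -[LHS]ma1; apply: eq_eseriesr => j _ /=.
    rewrite -!EFinM powRD ?powRr1//.
    by apply/implyP => _; rewrite gt_eqF// (lt_le_trans _ (a1 j)).
  rewrite star_density_potentialS => [|n]; last exact: poweR_ge0.
  by rewrite poweR1r mule1.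
- by apply: aeW => n; exact: star_solution_gt0.
Qed.

Lemma star_solution_Lnorm : 'N[sigma]_q%:E[star_solution] < +oo.
Proof.
rewrite unlock; apply: poweR_lty.
rewrite integral_star => [|n]; last exact: poweR_ge0.
rewrite abse1 poweR1r lte_add_pinfty ?ltry//.
(* The hub contributes 1 to the integral, and the leaves are compared termwise with [ma1]. *)
apply: (@le_lt_trans _ _ 1); last by rewrite ltry.
rewrite -[leRHS]ma1; apply: lee_nneseries => j _.
  by move=> _; rewrite mule_ge0 ?poweR_ge0// lee_fin.
rewrite gee0_abs ?lee_fin//= ler_wpM2l// ler_powR//.
by rewrite lerDr.
Qed.

End star.

Theorem mainTheorem9 (R : realType) (q : R)
    (hq0 : ((Num.sqrt 5 - 1) / 2 < q)%R) (hq1 : (q < 1)%R) :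
  exists (Omega : ptopologicalType)
         (sigma : {measure set (borel Omega) -> \bar R})
         (G : Omega * Omega -> \bar R),
    [/\ hausdorff_space Omega,
        locally_compact [set: Omega] &
        @second_countable Omega] /\
    locally_finite sigma /\
    [/\ forall z, 0 <= G z,
        forall x y, G (x, y) = G (y, x) &
        lower_semicontinuous G] /\
    (exists u : borel Omega -> \bar R,
        positive_solution G sigma q u /\ 'N[sigma]_q%:E[u] < +oo) /\
    \int[sigma]_x (potential G sigma x `^ (q / (1 - q))) = +oo.
Proof.
have q0 : (0 < q)%R.
  apply: lt_trans hq0; rewrite divr_gt0// subr_gt0.
  by rewrite -[ltLHS]sqrtr1 ltr_sqrt ?ltr1n.
have sq5 : (Num.sqrt 5 ^+ 2 = 5 :> R)%R by rewrite sqr_sqrtr.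
have s5 : (0 <= Num.sqrt (5 : R))%R by exact: sqrtr_ge0.
have ps : (1 + q < q / (1 - q))%R.
  (* Clearing the denominator leaves [(1+q)(1-q) < q], that is [q^2 + q - 1 > 0], a polynomial whose
     positive root is [(sqrt 5 - 1)/2]. *)
  rewrite ltr_pdivlMr ?subr_gt0//; nra.
have [a [m [a1 m0 ma1 maoo]]] := exists_critical_moments ps.
pose m' j : {nonneg R}%R := NngNum (m0 j).
exists nat, (atomic (star_weight m')), (star_kernel a).
split; first split.
- exact: discrete_hausdorff.
- exact: discrete_locally_compact.
- exact: nat_second_countable.
split; first exact: atomic_locally_finite.
split; first split.
- exact: star_kernel_ge0.
- exact: star_kernel_sym.
- exact: lower_semicontinuous_nat2.
split; last exact: integral_star_potential_pinfty.
exists (star_solution a); split; first exact: star_solution_positive.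
exact: star_solution_Lnorm.
Qed.
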